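(* Let $\varphi,\psi:\mathbb{R}^n\to\mathbb{R}$ be any two functions such that $f=e^{-\varphi}$ and $g=e^{-\psi}$ are integrable. If $J(f)>0$, then $\widehat{\delta J}(f,g)\in[cJ(f),+\infty]$ with $c=\inf\psi$, and $$\widehat{\delta J}(f,g)=\int_{\mathbb{R}^n}\psi(x)e^{-\varphi(x)}\,dx.$$
   Context: For an integrable function $h$ on $\mathbb{R}^n$, $J(h)=\int_{\mathbb{R}^n}h(x)\,dx$. For $f=e^{-\varphi}$, $g=e^{-\psi}$ integrable, the functional dual mixed volume is $$\widehat{\delta J}(f,g)=-\lim_{t\to0^+}\frac{J(e^{-(\varphi+t\psi)})-J(f)}{t}.$$
   Formalization: The integral formula is asserted only if inf ψ > -∞ or e^{-(φ+tψ)} is integrable for all small t > 0; otherwise it can fail (f = 1/(x ln³(1/x)), ψ = ½ ln x near 0). The interval claim is unconditional, with J = +∞ for non-integrable functions. *)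

(* Defs.v *)
From HB Require Import structures.
From mathcomp Require Import all_boot all_order all_algebra.
From mathcomp Require Import all_classical all_reals all_analysis.
Set Implicit Arguments.
Unset Strict Implicit.
Unset Printing Implicit Defensive.
Import Order.TTheory GRing.Theory Num.Theory.
Import numFieldNormedType.Exports.
Local Open Scope classical_set_scope.
Local Open Scope ring_scope.
Local Open Scope ereal_scope.

Section tuple_cons.
Variables (R : realType) (n : nat).
Local Notation tR := (measurableTypeR R).

Definition cons_pair (p : tR * n.-tuple tR) : n.+1.-tuple tR :=
  [the n.+1.-tuple tR of p.1 :: p.2].

Lemma measurable_cons_pair : measurable_fun [set: tR * n.-tuple tR] cons_pair.
Proof. exact: measurable_cons. Qed.

Definition uncons_pair (t : n.+1.-tuple tR) : tR * n.-tuple tR :=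
  (tnth t ord0, [tuple of behead t]).

Lemma measurable_uncons_pair : measurable_fun [set: n.+1.-tuple tR] uncons_pair.
Proof.
by apply: measurable_fun_pair; [exact: measurable_tnth|exact: measurable_behead].
Qed.

Lemma cons_pairK : cancel cons_pair uncons_pair.
Proof. by move=> [x t]; congr pair; exact/val_inj. Qed.

Definition cons_measure (m : set (n.-tuple tR) -> \bar R) :=
  pushforward (lebesgue_measure \x m) cons_pair.

Variable m : {sigma_finite_measure set (n.-tuple tR) -> \bar R}.

Let cons_measure0 : cons_measure m set0 = 0.
Proof. by rewrite /cons_measure /pushforward preimage_set0; exact: measure0. Qed.

Let cons_measure_ge0 A : 0 <= cons_measure m A.
Proof. by rewrite /cons_measure /pushforward; exact: measure_ge0. Qed.

Let cons_measure_sigma_additive : semi_sigma_additive (cons_measure m).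
Proof. by apply: measure_semi_sigma_additive; exact: measurable_cons_pair. Qed.

HB.instance Definition _ := isMeasure.Build _ _ _ (cons_measure m)
  cons_measure0 cons_measure_ge0 cons_measure_sigma_additive.

Let cons_measure_sigma_finite : sigma_finite setT (cons_measure m).
Proof.
have /sigma_finiteP[F [TF ndF Foo]] := sigma_finiteT (@lebesgue_measure R).
have /sigma_finiteP[G [TG ndG Goo]] := sigma_finiteT m.
exists (fun k => uncons_pair @^-1` (F k `*` G k)).
  rewrite -preimage_bigcup (_ : \bigcup_k _ = setT) ?preimage_setT//.
  apply/seteqP; split => // -[x t] _.
  have [i _ Fix] : (\bigcup_i F i) x by rewrite -TF.
  have [j _ Gjt] : (\bigcup_i G i) t by rewrite -TG.
  exists (maxn i j) => //; split => /=.
  - by move: x Fix; exact/subsetPset/ndF/leq_maxl.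
  - by move: t Gjt; exact/subsetPset/ndG/leq_maxr.
move=> k; have [mF Fk] := Foo k; have [mG Gk] := Goo k; split.
  rewrite -[X in measurable X]setTI; apply: measurable_uncons_pair => //.
  exact: measurableX.
rewrite /cons_measure /pushforward -comp_preimage.
rewrite (_ : _ \o _ = id); last by apply/funext => p; exact: cons_pairK.
by rewrite preimage_id product_measure1E// lte_mul_pinfty// ge0_fin_numE.
Qed.

HB.instance Definition _ := Measure_isSigmaFinite.Build _ _ _ (cons_measure m)
  cons_measure_sigma_finite.

End tuple_cons.

Section lebesgue.
Variable R : realType.
Local Notation tR := (measurableTypeR R).

(* Lebesgue measure on the Borel sigma-algebra of R^n (the product
   sigma-algebra on n-tuples), through R^(n+1) = R * R^n; R^0 is a point of
   mass 1. *)
Fixpoint borel_lebesgue n : {sigma_finite_measure set (n.-tuple tR) -> \bar R} :=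
  match n with
  | 0 => \d_([tuple] : 0.-tuple tR)
  | m.+1 => cons_measure (borel_lebesgue m)
  end.

(* R^n with the sigma-algebra of Lebesgue measurable sets, i.e. the completion
   of the Borel sigma-algebra for Lebesgue measure. *)
Definition lebesgue_space (n : nat) :=
  caratheodory_type (borel_lebesgue n)^*%mu.

Definition lebesgue_n (n : nat) :
    {measure set (lebesgue_space n) -> \bar R} :=
  @completed_measure_extension _ _ R (borel_lebesgue n).
End lebesgue.

Section functional_dual_mixed_volume.
Variables (R : realType) (n : nat).
Implicit Types h phi psi : n.-tuple R -> R.

Definition lebesgue_integrable h :=
  (@lebesgue_n R n).-integrable setT (EFin \o h).

(* Extended-real valued; a nonnegative measurable function which is not
   integrable has J h = +oo. *)
Definition J h : \bar R := \int[@lebesgue_n R n]_x (h x)%:E.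

Definition expN phi : n.-tuple R -> R := fun x => expR (- phi x).

Definition dJ_quotient phi psi (t : R) : \bar R :=
  (J (expN (fun x => phi x + t * psi x)%R) - J (expN phi)) * (t^-1)%:E.

(* In terms of phi = - ln f and psi = - ln g; meaningful when the limit exists. *)
Definition functional_dual_mixed_volume phi psi : \bar R :=
  - lim (dJ_quotient phi psi t @[t --> 0^'+]).

End functional_dual_mixed_volume.

(* Main.v *)
(** If [e^-(phi + t0 psi)] is integrable for some [t0 > 0], it is integrable for
    all smaller [t > 0], and the negated difference quotient is the integral of
    [(1 - e^(-t psi))/t * e^-phi].  By convexity of the exponential this
    integrand increases pointwise to [psi e^-phi] as [t] decreases to 0, so
    monotone convergence (from an integrable minorant) gives the limit.
    Otherwise the difference quotient is constantly [+oo], the dual mixed volume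
    is [-oo], and [psi] cannot be bounded below, so that [c * J f = -oo]. *)
Require Import Defs.
From mathcomp Require Import all_boot all_order all_algebra.
From mathcomp Require Import all_classical all_reals all_analysis.
From mathcomp Require Import measurable_realfun ring lra.
Set Implicit Arguments.
Unset Strict Implicit.
Unset Printing Implicit Defensive.
Import Order.TTheory GRing.Theory Num.Theory.
Import numFieldNormedType.Exports.
Local Open Scope classical_set_scope.
Local Open Scope ring_scope.
Local Open Scope ereal_scope.

(** * Convexity of the exponential and its chords from the origin *)

(* Combine the tangent lines of [expR] at [l * u], evaluated at [u] and at [0]. *)
Lemma expR_mul_le_conv (R : realType) (l u : R) : (0 <= l <= 1)%R ->
  (expR (l * u) <= 1 - l + l * expR u)%R.
Proof.
move=> /andP[l0 l1]; set e := expR (l * u).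
have e0 : (0 <= e)%R := expR_ge0 _.
have h1 : (e * (1 + (1 - l) * u) <= expR u)%R.
  rewrite [leRHS](_ : _ = e * expR ((1 - l) * u))%R.
    by rewrite ler_wpM2l// expR_ge1Dx.
  by rewrite -expRD; congr expR; ring.
have h2 : (e * (1 - l * u) <= 1)%R.
  rewrite [leRHS](_ : _ = e * expR (- (l * u)))%R.
    by rewrite ler_wpM2l// expR_ge1Dx.
  by rewrite -expRD subrr expR0.
have l1' : (0 <= 1 - l)%R by lra.
have := lerD (ler_wpM2l l0 h1) (ler_wpM2l l1' h2).
lra.
Qed.

(** The negated slope of the chord of [s |-> e^(-s a)] over [[0, t]]; the sign makes the limit at
    [0] equal to [a]. *)
Definition expN_slope (R : realType) (a t : R) : R :=
  ((1 - expR (- (t * a))) / t)%R.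

(** Convexity with weight [s / t] at [- (t * a)] bounds [e^(-s a)] by the chord over [[0, t]]. *)
Lemma expN_slope_nincr (R : realType) (a s t : R) : (0 < s)%R -> (s <= t)%R ->
  (expN_slope a t <= expN_slope a s)%R.
Proof.
move=> s0 st; have t0 : (0 < t)%R := lt_le_trans s0 st.
have st01 : (0 <= s / t <= 1)%R.
  by rewrite divr_ge0 ?ler_pdivrMr ?mul1r//= ltW.
have := expR_mul_le_conv (- (t * a)) st01.
rewrite (_ : s / t * - (t * a) = - (s * a))%R; last by field; rewrite gt_eqF.
move=> h; rewrite /expN_slope ler_pdivlMr// mulrAC mulrC mulrA.
have -> : (t^-1 * (1 - expR (- (t * a))) * s =
           s / t - s / t * expR (- (t * a)))%R by ring.
by lra.
Qed.

Lemma expN_slope_le (R : realType) (a t : R) : (0 < t)%R ->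
  (expN_slope a t <= a)%R.
Proof.
move=> t0; rewrite /expN_slope ler_pdivrMr//.
have := expR_ge1Dx (- (t * a)); lra.
Qed.

(** Multiply [1 + t a <= e^(t a)] by [e^(-t a)]. This is the lower half of the squeeze that gives
    the limit at [0]. *)
Lemma expN_slope_ge (R : realType) (a t : R) : (0 < t)%R ->
  (a * expR (- (t * a)) <= expN_slope a t)%R.
Proof.
move=> t0; rewrite /expN_slope ler_pdivlMr//.
have : (expR (- (t * a)) * (1 + t * a) <= 1)%R.
  rewrite [leRHS](_ : _ = expR (- (t * a)) * expR (t * a))%R.
    by rewrite ler_wpM2l ?expR_ge0 ?expR_ge1Dx.
  by rewrite -expRD addNr expR0.
lra.
Qed.

Lemma cvg_expN_slope (R : realType) (a : R) :
  expN_slope a t @[t --> 0%R^'+] --> a.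
Proof.
apply: (@squeeze_cvgr _ _ _ _ (fun t => a * expR (- (t * a)))%R (cst a)).
- near=> t; rewrite expN_slope_le ?expN_slope_ge//; near: t; exact: nbhs_right_gt.
- apply: cvg_at_right_filter.
  have cont : {for 0%R, continuous (fun t : R => a * expR (- (t * a)))%R}.
    apply: continuousM; first exact: cvg_cst.
    apply: (@continuous_comp _ _ _ (fun t : R => - (t * a))%R expR).
      by apply: cvgN; apply: cvgM; [exact: cvg_id|exact: cvg_cst].
    exact: continuous_expR.
  by move: cont; rewrite /prop_for /continuous_at mul0r oppr0 expR0 mulr1.
- exact: cvg_cst.
Unshelve. all: by end_near. Qed.

(** * Comparison and monotone convergence for signed integrands *)

(** Treating positive and negative parts separately accommodates infinite integrals, such as that of
    [psi * f] may be. *)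
Lemma le_integral_measurable d (T : measurableType d) (R : realType)
    (mu : {measure set T -> \bar R}) (f g : T -> \bar R) :
  measurable_fun setT f -> measurable_fun setT g -> (forall x, f x <= g x) ->
  \int[mu]_x f x <= \int[mu]_x g x.
Proof.
move=> mf mg fg; rewrite integralE [leRHS]integralE; apply: leeB.
- apply: ge0_le_integral => //; try exact: measurable_funepos.
  by move=> x _; apply: (@funepos_le _ _ setT) => //; rewrite in_setT.
- apply: ge0_le_integral => //; try exact: measurable_funeneg.
  by move=> x _; apply: (@funeneg_le _ _ setT) => //; rewrite in_setT.
Qed.

(* The positive parts converge monotonically; the negative parts are dominated
   by that of [F 0]. *)
Lemma cvg_integral_nondecreasing d (T : measurableType d) (R : realType)
    (mu : {measure set T -> \bar R}) (F : nat -> T -> R) (G : T -> R) :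
  (forall n, measurable_fun setT (F n)) ->
  mu.-integrable setT (EFin \o F 0%N) ->
  (forall x, {homo F^~ x : m n / (m <= n)%N >-> (m <= n)%R}) ->
  (forall x, F n x @[n --> \oo] --> G x) ->
  \int[mu]_x (F n x)%:E @[n --> \oo] --> \int[mu]_x (G x)%:E.
Proof.
move=> mF iF0 ndF FG.
have mFE n : measurable_fun setT (EFin \o F n) by exact: measurableT_comp.
(* Both parts of a function are maxima with [0], so they inherit pointwise convergence. *)
have maxcvg (u : nat -> R) l : u n @[n --> \oo] --> l ->
    Num.max (u n) 0%R @[n --> \oo] --> Num.max l 0%R.
  move=> ul; apply: (@cvg_comp _ _ _ u (fun r => Num.max r 0%R) _ (nbhs l)) => //.
  by apply: (@continuous_max R R id (cst 0%R)); [exact: cvg_id|exact: cvg_cst].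
have cvgp x : (EFin \o F n)^\+ x @[n --> \oo] --> (EFin \o G)^\+ x.
  rewrite funerpos; under eq_fun do rewrite funerpos.
  by apply: cvg_EFin; [exact: nearW|exact: maxcvg].
have cvgn x : (EFin \o F n)^\- x @[n --> \oo] --> (EFin \o G)^\- x.
  rewrite funerneg; under eq_fun do rewrite funerneg.
  by apply: cvg_EFin; [exact: nearW|apply: maxcvg; exact: cvgN].
rewrite integralE; under eq_fun do rewrite integralE.
have negF n x : (EFin \o F n)^\- x <= (EFin \o F 0%N)^\- x.
  apply: (@funeneg_le _ _ setT); rewrite ?in_setT// => y _.
  by rewrite lee_fin ndF.
have negG x : (EFin \o G)^\- x <= (EFin \o F 0%N)^\- x.
  apply: (cvge_to_le (cvgn x)); exact: nearW.
have mG : measurable_fun setT (EFin \o G).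
  apply: measurableT_comp => //; apply: measurable_fun_cvg (mF) _ => x _.
  exact: FG.
have iG : mu.-integrable setT (EFin \o G)^\-.
  apply: le_integrable (integrable_funeneg _ iF0) => //.
    exact: measurable_funeneg.
  by move=> x _; rewrite !gee0_abs.
apply: cvgeB.
(* The negative part of [G] has a finite integral, so the limit is not of the form [oo - oo]. *)
- by apply: fin_num_adde_defl; rewrite fin_numN; exact: integrable_fin_num.
- have -> : (EFin \o G)^\+ = fun x => limn (fun n => (EFin \o F n)^\+ x).
    by apply/funext => x; apply/esym/cvg_lim.
  apply: cvg_monotone_convergence => //.
    by move=> n; exact: (measurable_funepos (mFE n)).
  move=> x _ m n mn; apply: (@funepos_le _ _ setT); rewrite ?in_setT// => y _.
  by rewrite lee_fin ndF.
- apply: (dominated_cvg _ _ _ _ (integrable_funeneg _ iF0)) => //.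
  + by move=> n; exact: (measurable_funeneg (mFE n)).
  + by move=> x _; rewrite funerneg.
  + by move=> n x _; rewrite gee0_abs ?funeneg_ge0//; exact: negF.
Qed.

(** * Perturbing the exponent over a general measure space *)

Section expN_perturbation.
Variables (d : measure_display) (T : measurableType d) (R : realType).
Variables (mu : {measure set T -> \bar R}) (phi psi : T -> R).
Hypothesis mphi : measurable_fun setT phi.
Hypothesis mpsi : measurable_fun setT psi.

Let e t x : R := expR (- (phi x + t * psi x)).
Let f x : R := expR (- phi x).
Let D t x : R := (expN_slope (psi x) t * f x)%R.
Let quotient t : \bar R :=
  (\int[mu]_x (e t x)%:E - \int[mu]_x (f x)%:E) * (t^-1)%:E.

Hypothesis intf : mu.-integrable setT (EFin \o f).

Let measurable_e t : measurable_fun setT (e t).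
Proof.
apply: measurableT_comp; first exact: measurable_expR.
apply: measurable_funN; apply: measurable_funD => //.
exact: measurable_funM.
Qed.

Let measurable_f : measurable_fun setT f.
Proof. by apply: measurableT_comp => //; exact: measurable_funN. Qed.

(** Convexity gives [e^(-s psi) <= 1 + e^(-t psi)], so [f + e t] dominates [e s]. *)
Lemma integrable_expN_perturbation_le s t : (0 < s)%R -> (s <= t)%R ->
  mu.-integrable setT (EFin \o e t) -> mu.-integrable setT (EFin \o e s).
Proof.
move=> s0 st iet; have t0 : (0 < t)%R := lt_le_trans s0 st.
apply: (le_integrable _ _ _ (integrableD _ intf iet)) => //.
  exact: measurableT_comp.
move=> x _; rewrite !gee0_abs ?adde_ge0 ?lee_fin ?expR_ge0//=.
have st01 : (0 <= s / t <= 1)%R.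
  by rewrite divr_ge0 ?ler_pdivrMr ?mul1r//= ltW.
have := expR_mul_le_conv (- (t * psi x)) st01.
rewrite (_ : s / t * - (t * psi x) = - (s * psi x))%R; last first.
  by field; rewrite gt_eqF.
rewrite /e /f !opprD !expRD => h.
have f0 := expR_ge0 (- phi x); have e0 := expR_ge0 (- (t * psi x)).
rewrite -[X in (_ <= X + _)%R]mulr1 -mulrDr ler_wpM2l//.
by apply: (le_trans h); case/andP: st01 => ? ?; rewrite lerD ?gerBl ?ler_piMl.
Qed.

(** Pointwise, [D t] is [-1/t] times [e t - f]; integrability of both terms allows linearity. *)
Lemma difference_quotientE t : (0 < t)%R -> mu.-integrable setT (EFin \o e t) ->
  mu.-integrable setT (EFin \o D t) /\ quotient t = - \int[mu]_x (D t x)%:E.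
Proof.
move=> t0 iet.
have DE x : (- (t^-1)%:E) * ((e t x)%:E - (f x)%:E) = (D t x)%:E.
  rewrite -EFinN -EFinB -EFinM; congr EFin.
  by rewrite /D /expN_slope /e /f opprD expRD; ring.
have iB := integrableB measurableT iet intf.
split.
  have := integrableZl measurableT (- t^-1)%R iB.
  by apply: eq_integrable => // x _; exact: DE.
under [in RHS]eq_integral do rewrite -DE.
rewrite -EFinN integralZl// integralB// /quotient.
by rewrite EFinN mulNe oppeK muleC.
Qed.

(** The nonnegative function [e t] has integral [+oo], while that of [f] is finite. *)
Lemma difference_quotient_pinfty t : (0 < t)%R ->
  ~ mu.-integrable setT (EFin \o e t) ->
  quotient t = +oo.
Proof.
move=> t0 niet; rewrite /quotient.
have -> : \int[mu]_x (e t x)%:E = +oo.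
  apply: contrapT => /eqP ne; apply: niet; apply/integrableP; split.
    exact: measurableT_comp.
  under eq_integral do rewrite gee0_abs ?lee_fin ?expR_ge0//.
  by rewrite ltey.
have := integrable_fin_num measurableT intf.
rewrite -fin_numN => /fin_numP[? _].
by rewrite addye ?gt0_mulye ?lte_fin ?invr_gt0.
Qed.

(** Monotonicity in [t] makes the right limit exist as an infimum [l]; its value is then found along
    a sequence. *)
Lemma cvg_difference_quotient t0 : (0 < t0)%R ->
  mu.-integrable setT (EFin \o e t0) ->
  quotient t @[t --> 0%R^'+] --> - \int[mu]_x (psi x * f x)%:E.
Proof.
move=> t00 iet0.
have iet s : (0 < s)%R -> (s <= t0)%R -> mu.-integrable setT (EFin \o e s).
  by move=> s0 st; exact: integrable_expN_perturbation_le iet0.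
have mD t : (0 < t)%R -> (t <= t0)%R -> measurable_fun setT (EFin \o D t).
  move=> t0' tt; have [iD _] := difference_quotientE t0' (iet _ t0' tt).
  exact: measurable_int iD.
have Dmono x s t : (0 < s)%R -> (s <= t)%R -> (D t x <= D s x)%R.
  by move=> s0 st; rewrite ler_wpM2r ?expR_ge0// expN_slope_nincr.
have qmono : {in Interval (BRight 0%R) (BRight t0) &,
    {homo quotient : s t / (s <= t)%R >-> s <= t}}.
  move=> s t; rewrite !in_itv/= => /andP[s0 st0] /andP[t0' tt0] st.
  rewrite (difference_quotientE s0 (iet _ s0 st0)).2.
  rewrite (difference_quotientE t0' (iet _ t0' tt0)).2.
  rewrite leeN2; apply: le_integral_measurable; [exact: mD|exact: mD|].
  by move=> x; rewrite lee_fin Dmono.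
have := nondecreasing_at_right_cvge (BRight t0) _ qmono.
rewrite bnd_simp => /(_ t00); set l := ereal_inf _ => ql.
(* The points [t0 / (n + 1)] decrease to [0] within []0, t0]], where all perturbations are
   integrable. *)
pose u n : R := (t0 * harmonic n)%R.
have u_gt0 n : (0 < u n)%R by rewrite mulr_gt0 // invr_gt0.
have u_le n : (u n <= t0)%R.
  by rewrite ler_piMr ?(ltW t00)// invf_le1 // ler1n.
have u0 : u n @[n --> \oo] --> (0 : R)%R^'+.
  have u0 : u n @[n --> \oo] --> (0 : R)%R.
    by rewrite -(mulr0 t0); apply: cvgMr; exact: cvg_harmonic.
  by move=> A A0; have [N _ uA] := u0 _ A0; exists N => // n /uA; exact.
have qul : quotient (u n) @[n --> \oo] --> l by apply: cvg_comp ql.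
have quI : quotient (u n) @[n --> \oo] --> - \int[mu]_x (psi x * f x)%:E.
  have -> : (fun n => quotient (u n)) = (fun n => - \int[mu]_x (D (u n) x)%:E).
    apply/funext => n.
    exact: (difference_quotientE (u_gt0 n) (iet _ (u_gt0 n) (u_le n))).2.
  (* The integrable minorant is [D (u 0)], and [u 0] is [t0]. *)
  apply: cvgeN; apply: cvg_integral_nondecreasing.
  - by move=> n; apply/measurable_EFinP; exact: mD.
  - exact: (difference_quotientE (u_gt0 0%N) (iet _ (u_gt0 0%N) (u_le 0%N))).1.
  - move=> x m n mn; apply: Dmono => //.
    by rewrite ler_wpM2l ?(ltW t00)// lef_pV2 ?posrE// ler_nat.
  - move=> x; have su : expN_slope (psi x) (u n) @[n --> \oo] --> psi x.
      by apply: (cvg_comp _ _ u0); exact: cvg_expN_slope.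
    exact: cvgMl su.
by rewrite -(cvg_unique _ qul quI).
Qed.

Lemma lower_bound_weighted_integral c : (forall x, c <= psi x)%R ->
  c%:E * \int[mu]_x (f x)%:E <= \int[mu]_x (psi x * f x)%:E.
Proof.
move=> cpsi; rewrite -integralZl//; apply: le_integral_measurable.
- by apply: measurable_funeM; exact: measurableT_comp.
- by apply: measurableT_comp => //; exact: measurable_funM.
- by move=> x; rewrite -EFinM lee_fin ler_wpM2r ?expR_ge0.
Qed.

(** The multiple [e^(-t c) f] of [f] dominates. *)
Lemma integrable_expN_perturbation_bounded_below c t :
  (forall x, c <= psi x)%R -> (0 < t)%R -> mu.-integrable setT (EFin \o e t).
Proof.
move=> cpsi t0.
have ief := integrableZl measurableT (expR (- (t * c))) intf.
apply: (le_integrable _ _ _ ief) => //.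
  exact: measurableT_comp.
move=> x _; rewrite !gee0_abs ?mule_ge0 ?lee_fin ?expR_ge0//=.
rewrite -expRD ler_expR opprD addrC lerD2r lerN2 ler_wpM2l// ltW//.
Qed.

End expN_perturbation.

(** * Conclusion for Lebesgue measure on [R^n] *)

Lemma measurable_expN_inv d (T : measurableType d) (R : realType) (h : T -> R) :
  measurable_fun setT (fun x => expR (- h x)) -> measurable_fun setT h.
Proof.
move=> me; rewrite (_ : h = \- (@ln R \o (fun x => expR (- h x))))%R.
  by apply: measurable_funN; apply: measurableT_comp me; exact: measurable_ln.
by apply/funext => x /=; rewrite expRK opprK.
Qed.

(** The disjunction guarding the integral formula excludes the case where no perturbation is
    integrable: there the limit gives [-oo], whatever the integral is. *)
Theorem theorem3p1 (R : realType) (n : nat) (phi psi : n.-tuple R -> R) :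
  lebesgue_integrable (expN phi) ->
  lebesgue_integrable (expN psi) ->
  0 < J (expN phi) ->
  let c := ereal_inf (range (EFin \o psi)) in
  [/\ cvg (dJ_quotient phi psi t @[t --> 0^'+]),
      functional_dual_mixed_volume phi psi
        \in `[c * J (expN phi), +oo%E] &
      -oo < c \/
      (\forall t \near 0^'+,
         lebesgue_integrable (expN (fun x => phi x + t * psi x)%R)) ->
      functional_dual_mixed_volume phi psi =
        \int[@lebesgue_n R n]_x (psi x * expR (- phi x))%:E].
Proof.
move=> iphi ipsi J0 c.
have mphi : measurable_fun setT (phi : lebesgue_space R n -> R).
  apply: measurable_expN_inv; apply/measurable_EFinP; exact: measurable_int iphi.
have mpsi : measurable_fun setT (psi : lebesgue_space R n -> R).
  apply: measurable_expN_inv; apply/measurable_EFinP; exact: measurable_int ipsi.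
(* Evaluating [psi] at the zero tuple rules out [c = +oo]. *)
have c_real : -oo < c -> exists r, c = r%:E /\ (forall x, r <= psi x)%R.
  have c_le x : c <= (psi x)%:E by apply: ereal_inf_lbound; exists x.
  move: c_le; case: c => [r|/(_ [tuple of nseq n 0%R])|]//.
  by move=> c_le _; exists r; split=> // x; rewrite -lee_fin.
have [[t0 [t00 it0]]|nint] := pselect (exists t0 : R, (0 < t0)%R /\
    lebesgue_integrable (expN (fun x => phi x + t0 * psi x)%R)).
- have qcvg := cvg_difference_quotient mphi mpsi iphi t00 it0.
  have volE : functional_dual_mixed_volume phi psi =
      \int[@lebesgue_n R n]_x (psi x * expR (- phi x))%:E.
    by rewrite /functional_dual_mixed_volume (cvg_lim _ qcvg)// oppeK.
  split=> //; first by apply/cvg_ex; eexists; exact: qcvg.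
  rewrite volE in_itv/= leey andbT.
  have [/c_real[r [-> rpsi]]|] := ltP -oo c.
    exact: lower_bound_weighted_integral.
  (* When [c = -oo], positivity of [J (expN phi)] makes the lower endpoint [-oo]. *)
  by rewrite leeNy_eq => /eqP ->; rewrite gt0_mulNye// leNye.
- have qE t : (0 < t)%R -> dJ_quotient phi psi t = +oo.
    move=> t0; apply: (difference_quotient_pinfty mphi mpsi iphi t0) => it.
    by apply: nint; exists t.
  have qcvg : dJ_quotient phi psi t @[t --> 0^'+] --> +oo.
    apply: cvg_near_cst; near=> t; apply: qE; near: t; exact: nbhs_right_gt.
  have volE : functional_dual_mixed_volume phi psi = -oo.
    by rewrite /functional_dual_mixed_volume (cvg_lim _ qcvg).
  (* A finite lower bound of [psi] would make the perturbation at [t = 1] integrable. *)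
  have cE : ~ (-oo < c).
    move=> /c_real[r [_ rpsi]]; apply: nint; exists 1%R; split=> //.
    exact: (integrable_expN_perturbation_bounded_below mphi mpsi iphi rpsi).
  split; first by apply/cvg_ex; eexists; exact: qcvg.
  + move/negP: cE; rewrite -leNgt leeNy_eq => /eqP ->.
    by rewrite volE in_itv/= gt0_mulNye// !leNye.
  + move=> [/cE//|near_int]; exfalso; apply: nint.
    (* Integrability near [0] from the right would supply some [t > 0], contradicting [nint]. *)
    apply: (@filter_ex _ (0%R^'+ : set_system R)).
    by near=> t; split; near: t => //; exact: nbhs_right_gt.
Unshelve. all: by end_near. Qed.
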